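(* Let $X \in \mathbb{R}^d$ be an activation vector (a row vector), and let $R \in \mathbb{R}^{d \times d}$ be a normalized Hadamard matrix. Define $\delta = \Vert X \Vert_1 / \left(d \Vert X \Vert_\infty\right)$. Then the rotation of $X$ by $R$ satisfies $$\Vert XR\Vert_\infty \leq \delta \sqrt{d}\,\Vert X \Vert_\infty .$$
   Context: A normalized Hadamard matrix $R \in \mathbb{R}^{k \times k}$ is an orthogonal matrix all of whose entries are $\pm 1/\sqrt{k}$; in particular each column $R_i$ satisfies $\Vert R_i\Vert_2 = 1$ and $\Vert R_i \Vert_\infty = 1/\sqrt{k}$. Vectors are row vectors, ''activation vector'' just means a vector in $\mathbb{R}^d$, and $\Vert\cdot\Vert_1$, $\Vert\cdot\Vert_2$, $\Vert\cdot\Vert_\infty$ are the usual vector norms. *)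

(* Defs.v *)
From mathcomp Require Import all_boot all_order all_algebra.
From mathcomp Require Import reals normedtype.
Set Implicit Arguments.
Unset Strict Implicit.
Unset Printing Implicit Defensive.
Import Order.TTheory GRing.Theory Num.Theory.
Import numFieldNormedType.Exports.
Local Open Scope ring_scope.

(* The supremum norm of a row vector [X] is the canonical norm [`|X|] on       *)
(* matrices ([mx_norm], the largest absolute value of an entry).              *)
Definition norm1 (K : realType) (d : nat) (X : 'rV[K]_d) : K :=
  \sum_(j < d) `|X 0 j|.

(* For square matrices over a field this already implies [A^T *m A = 1%:M].   *)
Definition orthogonal_mx (K : realType) (k : nat) (A : 'M[K]_k) : Prop :=
  A *m A^T = 1%:M.

Definition normalized_hadamard (K : realType) (k : nat) (R : 'M[K]_k) : Prop :=
  orthogonal_mx R /\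
  forall i j : 'I_k,
    R i j = 1 / Num.sqrt k%:R \/ R i j = - (1 / Num.sqrt k%:R).

(* Division by zero is zero in MathComp, hence [delta X = 0] if [X = 0].      *)
Definition delta (K : realType) (d : nat) (X : 'rV[K]_d) : K :=
  norm1 X / (d%:R * `|X|).

(* Main.v *)
Require Import Defs.
From mathcomp Require Import all_boot all_order all_algebra.
From mathcomp Require Import reals normedtype.
Import Order.TTheory GRing.Theory Num.Theory.
Import numFieldNormedType.Exports.
Local Open Scope ring_scope.

(** All entries of [R] have absolute value 1/sqrt d ([normalized_hadamard_norm]), so by the triangle
    inequality each entry of [X *m R] is at most [norm1 X] / sqrt d in absolute value. For nonzero
    [X] this bound equals the right-hand side: unfolding [delta], the sup norm of [X] and one factor
    sqrt d cancel. *)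

Lemma normalized_hadamard_norm (K : realType) (d : nat) (R : 'M[K]_d)
    (hR : normalized_hadamard R) (i j : 'I_d) :
  `|R i j| = (Num.sqrt d%:R)^-1.
Proof.
have s0 : 0 <= (Num.sqrt d%:R : K)^-1 by rewrite invr_ge0 sqrtr_ge0.
by case: (hR.2 i j) => ->; rewrite div1r ?normrN ger0_norm.
Qed.

Theorem proposition3p1 (K : realType) (d : nat) (X : 'rV[K]_d) (R : 'M[K]_d)
    (hR : normalized_hadamard R) :
  `|X *m R| <= delta X * Num.sqrt d%:R * `|X|.
Proof.
(* The cancellation divides by the sup norm of [X], so [X = 0] is settled apart; both sides are then
   0. *)
have [->|X0] := eqVneq X 0; first by rewrite mul0mx !normr0 mulr0.
have d0 : (0 < d)%N.
  by case: d X {R hR} X0 => // X; rewrite thinmx0 eqxx.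
have dE : (d%:R : K) = Num.sqrt d%:R ^+ 2 by rewrite sqr_sqrtr ?ler0n.
have s0 : (Num.sqrt d%:R : K) != 0 by rewrite sqrtr_eq0 -ltNge ltr0n.
have -> : delta X * Num.sqrt d%:R * `|X| = norm1 X * (Num.sqrt d%:R)^-1.
  rewrite /delta {1}dE invfM expr2 invfM.
  by rewrite !mulrA -(mulrA _ _ `|X|) (mulrC _ `|X|) mulrA mulfVK ?normr_eq0 // mulfVK.
(* The sup norm unfolds to a maximum with base value 0, so the bound must also dominate 0. *)
have b0 : 0 <= norm1 X * (Num.sqrt d%:R)^-1.
  by rewrite mulr_ge0 ?sumr_ge0 // invr_ge0 sqrtr_ge0.
rewrite [leLHS]mx_normrE; apply/bigmax_leP; split => // -[i j] _ /=.
rewrite mxE ord1 /norm1 mulr_suml (le_trans (ler_norm_sum _ _ _)) //.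
by apply: ler_sum => k _; rewrite normrM normalized_hadamard_norm.
Qed.
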